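(* Let $f$ be an $S$-perfect structure over a distance-regular graph $G$ with $P$-polynomials $\Pi_0,\Pi_1,\dots,\Pi_{\mathrm{diam}(G)}$. If the value of $f$ at a vertex $x$ is $f_0$, then the tuple $$(f_0=f_0\Pi_0(S),\ f_0\Pi_1(S),\ \dots,\ f_0\Pi_{\mathrm{diam}(G)}(S))^{T}$$ is the weight distribution of $f$ with respect to $x$.
   Context: Let $G=(V,E)$ be a finite connected simple graph with adjacency matrix $A$. For a real $\nu\times\nu$ matrix $S$, a real $|V|\times\nu$ matrix $f$ is an $S$-perfect structure over $G$ (i.e. over $A$) if $Af=fS$; $f$ is also regarded as a function on $V$ whose value $f(v)$ is the row of $f$ indexed by $v$. For $w=0,\dots,\mathrm{diam}(G)$ let $A_w$ be the distance-$w$ matrix of $G$ (its $(i,j)$ entry is $1$ if the graph distance between $i$ and $j$ is $w$, and $0$ otherwise). $G$ is distance-regular if for every such $w$ one has $A_w=\Pi_w(A)$ for some polynomial $\Pi_w$ of degree $w$; the polynomials $\Pi_0,\dots,\Pi_{\mathrm{diam}(G)}$ are called the $P$-polynomials of $G$. The weight distribution of $f$ with respect to a vertex $x$ is the tuple $(h_0,h_1,\dots,h_{\mathrm{diam}(G)})^{T}$ where $h_w$ is the sum of $f(v)$ over all vertices $v$ at distance $w$ from $x$. *)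

(* Defs.v *)
From HB Require Import structures.
From mathcomp Require Import all_boot all_order all_algebra.
From mathcomp Require Import reals.

Set Implicit Arguments.
Unset Strict Implicit.
Unset Printing Implicit Defensive.

Import Order.TTheory GRing.Theory Num.Theory.
Local Open Scope ring_scope.

(* mathcomp's horner_mx only covers nonempty square matrices ('M_n.+1); this
   version makes sense for 'M_n with n arbitrary, e.g. n = #|V|. *)
Definition mxeval (R : comNzRingType) (n : nat) (p : {poly R}) (A : 'M[R]_n) :
    'M[R]_n :=
  \sum_(i < size p) p`_i *: A ^+ i.

Lemma mxeval_horner (R : comNzRingType) (n : nat) (p : {poly R})
  (A : 'M[R]_n.+1) : mxeval p A = horner_mx A p.
Proof.
rewrite -[p in RHS]coefK poly_def rmorph_sum; apply: eq_bigr => i _ /=.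
by rewrite horner_mxZ rmorphXn /= horner_mx_X.
Qed.

Definition connected_graph (V : finType) (e : rel V) : Prop :=
  forall x y : V, connect e x y.

Definition has_walk (V : finType) (e : rel V) (x y : V) (k : nat) : bool :=
  [exists p : k.-tuple V, path e x p && (last x p == y)].

(* The default value #|V|, returned when y is not reachable from x, is never
   taken in a connected graph: see gdist_walk and gdist_min. *)
Definition gdist (V : finType) (e : rel V) (x y : V) : nat :=
  find (has_walk e x y) (iota 0 #|V|).

Lemma has_walkP (V : finType) (e : rel V) (x y : V) (k : nat) :
  reflect (exists p, [/\ path e x p, last x p = y & size p = k])
          (has_walk e x y k).
Proof.
apply: (iffP existsP) => [[p /andP[xp /eqP lp]]|[p [xp lp sp]]].
  by exists p; rewrite size_tuple.
have sp' : size p == k by apply/eqP.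
by exists (Tuple sp'); rewrite /= xp lp eqxx.
Qed.

Lemma gdist_walk (V : finType) (e : rel V) (x y : V) :
  connect e x y -> has_walk e x y (gdist e x y).
Proof.
case/connectP=> p0 /shortenP[p xp up _] ->.
set z := last x p.
have szp : (size p < #|V|)%N.
  by rewrite -[(size p).+1]/(size (x :: p)) -(card_uniqP up) max_card.
have hs : has (has_walk e x z) (iota 0 #|V|).
  apply/hasP; exists (size p); first by rewrite mem_iota.
  by apply/has_walkP; exists p.
have := nth_find 0%N hs; rewrite nth_iota ?add0n //.
by rewrite -[X in (_ < X)%N](size_iota 0 #|V|) -has_find.
Qed.

Lemma gdist_min (V : finType) (e : rel V) (x y : V) (k : nat) :
  has_walk e x y k -> (gdist e x y <= k)%N.
Proof.
move=> xyk; rewrite leqNgt; apply/negP => ltk.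
have ltV : (k < #|V|)%N.
  by rewrite (leq_trans ltk) // -[X in (_ <= X)%N](size_iota 0 #|V|) find_size.
by have := before_find 0%N ltk; rewrite nth_iota // add0n xyk.
Qed.

Definition diameter (V : finType) (e : rel V) : nat :=
  (\max_(x : V) \max_(y : V) gdist e x y)%N.

(* Matrices indexed by V have index type 'I_#|V|; vertices are transported
   along enum_val / enum_rank. *)
Definition adjmx (R : realType) (V : finType) (e : rel V) : 'M[R]_#|V| :=
  \matrix_(i, j) (e (enum_val i) (enum_val j))%:R.

Definition distmx (R : realType) (V : finType) (e : rel V) (w : nat) :
    'M[R]_#|V| :=
  \matrix_(i, j) (gdist e (enum_val i) (enum_val j) == w)%:R.

Definition P_polynomials (R : realType) (V : finType) (e : rel V)
    (P : 'I_(diameter e).+1 -> {poly R}) : Prop :=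
  forall w : 'I_(diameter e).+1,
    size (P w) = w.+1 /\ distmx R e w = mxeval (P w) (adjmx R e).

Definition distance_regular (R : realType) (V : finType) (e : rel V) : Prop :=
  exists P : 'I_(diameter e).+1 -> {poly R}, P_polynomials P.

Definition perfect_structure (R : realType) (V : finType) (e : rel V)
    (nu : nat) (S : 'M[R]_nu) (f : 'M[R]_(#|V|, nu)) : Prop :=
  adjmx R e *m f = f *m S.

Definition value_at (R : realType) (V : finType) (nu : nat)
    (f : 'M[R]_(#|V|, nu)) (v : V) : 'rV[R]_nu :=
  row (enum_rank v) f.

(* The column (h_0, ..., h_diam)^T of row vectors h_w, as a matrix with
   rows h_w. *)
Definition weight_distribution (R : realType) (V : finType) (e : rel V)
    (nu : nat) (f : 'M[R]_(#|V|, nu)) (x : V) : 'M[R]_((diameter e).+1, nu) :=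
  \matrix_(w < (diameter e).+1) \sum_(v : V | gdist e x v == w) value_at f v.

(* Main.v *)
Require Import Defs.
From HB Require Import structures.
From mathcomp Require Import all_boot all_order all_algebra.
From mathcomp Require Import reals.

Set Implicit Arguments.
Unset Strict Implicit.
Unset Printing Implicit Defensive.

Import Order.TTheory GRing.Theory Num.Theory.
Local Open Scope ring_scope.

(** Right multiplication by [S] imitates multiplication by the adjacency
    matrix [A] on the left: [A f = f S] iterates to [A^i f = f S^i], and by
    linearity [p(A) f = f p(S)] for every polynomial [p] (lemma
    [mxeval_intertwine]). For [p = P w] the matrix [p(A)] is the distance-[w]
    matrix, whose row at [x] is the indicator of the sphere of radius [w]
    around [x]; so the row at [x] of [p(A) f] is the sum of [f] over that
    sphere (lemma [value_at_distmx_mul]), whereas the row at [x] of [f p(S)] is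
    [f0 p(S)]. This gives every entry of the weight distribution. The identity
    [f0 = f0 P_0(S)] is the entry at [w = 0], because the sphere of radius [0]
    around [x] is [x] alone (lemma [gdist_eq0]). *)

Lemma mulmx_exp_intertwine (R : comNzRingType) (m n : nat)
    (A : 'M[R]_m) (S : 'M[R]_n) (f : 'M[R]_(m, n)) (i : nat) :
  A *m f = f *m S -> A ^+ i *m f = f *m S ^+ i.
Proof.
move=> Af; elim: i => [|i IHi]; first by rewrite !expr0 mul1mx mulmx1.
by rewrite !exprSr -!mulmxE -mulmxA Af !mulmxA IHi.
Qed.

Lemma mxeval_intertwine (R : comNzRingType) (m n : nat) (p : {poly R})
    (A : 'M[R]_m) (S : 'M[R]_n) (f : 'M[R]_(m, n)) :
  A *m f = f *m S -> mxeval p A *m f = f *m mxeval p S.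
Proof.
move=> Af; rewrite /mxeval mulmx_suml mulmx_sumr; apply: eq_bigr => i _.
by rewrite -scalemxAl -scalemxAr (mulmx_exp_intertwine _ Af).
Qed.

Lemma value_at_distmx_mul (R : realType) (V : finType) (e : rel V) (nu : nat)
    (f : 'M[R]_(#|V|, nu)) (w : nat) (x : V) :
  value_at (distmx R e w *m f) x = \sum_(v | gdist e x v == w) value_at f v.
Proof.
rewrite /value_at row_mul mulmx_sum_row [RHS]big_mkcond /=.
rewrite (reindex enum_rank) /=; last exact/onW_bij/enum_rank_bij.
apply: eq_bigr => v _; rewrite !mxE !enum_rankK.
by case: ifP => _; rewrite ?scale1r ?scale0r.
Qed.

Lemma gdist_eq0 (V : finType) (e : rel V) (x y : V) :
  connect e x y -> (gdist e x y == 0)%N = (y == x).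
Proof.
move=> xy; apply/eqP/eqP => [d0 | ->].
  by have := gdist_walk xy; rewrite d0 => /has_walkP[p [_ <- /size0nil ->]].
by apply/eqP; rewrite -leqn0; apply: gdist_min; apply/has_walkP; exists [::].
Qed.

Theorem theorem3 (R : realType) (V : finType) (e : rel V)
  (e_sym : symmetric e) (e_irr : irreflexive e) (e_conn : connected_graph e)
  (e_dreg : distance_regular R e)
  (P : 'I_(diameter e).+1 -> {poly R}) (hP : P_polynomials P)
  (nu : nat) (S : 'M[R]_nu) (f : 'M[R]_(#|V|, nu))
  (hf : perfect_structure e S f)
  (x : V) (f0 : 'rV[R]_nu) (hf0 : value_at f x = f0) :
  f0 = f0 *m mxeval (P ord0) S /\
  \matrix_(w < (diameter e).+1) (f0 *m mxeval (P w) S)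
    = weight_distribution e f x.
Proof.
rewrite -{f0}hf0.
have sphere_sum (w : 'I_(diameter e).+1) : value_at f x *m mxeval (P w) S
    = \sum_(v | gdist e x v == w) value_at f v.
  have [_ distE] := hP w.
  by rewrite -value_at_distmx_mul distE (mxeval_intertwine _ hf) /value_at row_mul.
split; last by apply/row_matrixP => w; rewrite !rowK.
rewrite sphere_sum (eq_bigl (pred1 x)) ?big_pred1_eq // => v.
exact: gdist_eq0 (e_conn x v).
Qed.
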